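(* Let $n\ge 1$, let $\lambda$ be an $n$-partition, let $\sigma\in S_n^\lambda$, and let $T\in\mathcal{T}_\lambda$. Then $M(T)\ge Y_\lambda(\sigma)$ if and only if $T(l,k)\in F_\lambda(T,\sigma;l,k)$ for all $(l,k)\in\lambda$.
   Context: Notation. Fix $n\ge 1$. For integers $p,q$, $[p,q]=\{p,p+1,\dots,q\}$ (empty if $p>q$). An $n$-partition is $\lambda=(\lambda_1\ge\dots\ge\lambda_n\ge 0)$, integers. Its shape has $\lambda_i$ left-justified boxes in row $i$ (row 1 at the top). The box in column $j$ and row $i$ is written $(j,i)\in\lambda$ (column index first). The column lengths are $\zeta_1,\dots,\zeta_{\lambda_1}$. A semistandard tableau $T$ of shape $\lambda$ is a filling with values $T(j,i)\in[1,n]$ such that $T(j,i)\le T(j+1,i)$ and $T(j,i)<T(j,i+1)$; $\mathcal{T}_\lambda$ is the set of these. Boundary convention: $T(l,k+1):=n+1$ if $k=\zeta_l$. For tableaux of the same shape, $T\le U$ (or $U\ge T$) means $T(j,i)\le U(j,i)$ for all boxes. Permutations and keys. $S_n$ is the set of $n$-tuples $\sigma=(\sigma_1,\dots,\sigma_n)$ with distinct entries from $[1,n]$. Let $q_1<\dots<q_r$ be the distinct column lengths of $\lambda$, $q_0:=0$, $q_{r+1}:=n$. $S_n^\lambda$ is the set of $\sigma\in S_n$ such that $\sigma_i<\sigma_j$ whenever $i<j$ both lie in $[q_{s-1}+1,q_s]$ for some $1\le s\le r+1$. The $\lambda$-key $Y=Y_\lambda(\sigma)$ is the tableau of shape $\lambda$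 whose $j$th column consists of $\sigma_1,\dots,\sigma_{\zeta_j}$ sorted increasingly from top to bottom, with entries $Y(j,i)$. Left scanning tableau. Given a semistandard tableau $X$ and a location $(l,k)$ of $X$, the maximizing weakly decreasing sequence (MWDS) from $(l,k)$ in $X$ starts with $X(l,k)$ and then successively, for columns $l-1,l-2,\dots,1$, takes the maximum value in that column of $X$ that is less than or equal to the most recent value taken; the locations of these values form a left scanning path. For $T\in\mathcal{T}_\lambda$ and $1\le l\le\lambda_1$, let $T^{(l,\zeta_l)}$ be $T$ with all columns to the right of column $l$ removed. For $k=\zeta_l,\zeta_l-1,\dots,1$: form in $T^{(l,k)}$ the MWDS from $(l,k)$, let $M(l,k)$ be its last value (in the first column), and obtain $T^{(l,k-1)}$ from $T^{(l,k)}$ by removing all locations in this path and all locations beneath them in their columns. The left scanning tableau $M(T)$ is the filling of $\lambda$ with value $M(l,k)$ at $(l,k)$. The sets $F$. For $l=1$, $F_\lambda(T,\sigma;1,k):=[Y(1,k),\,T(1,k+1)-1]$. For $l\ge 2$, let $V=V^{(l,k)}$ be $T^{(l,k)}$ with its rightmost remaining column (column $l$) removed. Let $q$ be maximal such that $(l-1,q)$ is a location of $V$ and $V(l-1,q)\le T(l,k+1)-1$. For $k\le h\le q$ form in $V$ the MWDS from $(l-1,h)$ (all within $V$, without removing any path as they are formed) and let $g_h$ be its final value, in the first column; one has $g_q\ge g_{q-1}\ge\cdots\ge g_k$. Let $p\in[k,q]$ be minimal such that $g_p\ge Y(l,k)$. If no such $p$ exists, $F_\lambda(T,\sigma;l,k):=\emptyset$;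 otherwise $F_\lambda(T,\sigma;l,k):=[T(l-1,p),\,T(l,k+1)-1]$. *)

(* Defs.v *)
From mathcomp Require Import all_boot.

Set Implicit Arguments.
Unset Strict Implicit.
Unset Printing Implicit Defensive.

(* An [n]-partition is a weakly decreasing [lam : n.-tuple nat].  A filling is
   the sequence of its columns, from left to right, each listed from top to
   bottom.  All row and column indices are 1-based, column index first. *)

Definition filling := seq (seq nat).

Definition is_partition n (lam : n.-tuple nat) : bool := sorted geq lam.

Definition part n (lam : n.-tuple nat) (i : nat) : nat := nth 0 lam i.-1.

Definition box n (lam : n.-tuple nat) (j i : nat) : bool :=
  [&& 1 <= i <= n, 1 <= j & j <= part lam i].

Definition zeta n (lam : n.-tuple nat) (j : nat) : nat :=
  count (fun m => j <= m) lam.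

Definition column_lengths n (lam : n.-tuple nat) : seq nat :=
  [seq zeta lam j | j <- iota 1 (part lam 1)].

Definition column (T : filling) (j : nat) : seq nat := nth [::] T j.-1.

Definition entry (T : filling) (j i : nat) : nat := nth 0 (column T j) i.-1.

(* [T(j,i)], extended by [n+1] just below the bottom of column [j] *)
Definition bentry (n : nat) (T : filling) (j i : nat) : nat :=
  if i <= size (column T j) then entry T j i else n.+1.

Definition semistandard n (lam : n.-tuple nat) (T : filling) : Prop :=
  [/\ shape T = column_lengths lam,
      forall j i, box lam j i -> 1 <= entry T j i <= n,
      forall j i, box lam j i -> box lam j.+1 i ->
        entry T j i <= entry T j.+1 i
    & forall j i, box lam j i -> box lam j i.+1 ->
        entry T j i < entry T j i.+1].

Definition tab_le n (lam : n.-tuple nat) (T U : filling) : Prop :=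
  forall j i, box lam j i -> entry T j i <= entry U j i.

Definition is_perm_tuple n (sigma : n.-tuple nat) : bool :=
  uniq sigma && all (fun x => 1 <= x <= n) sigma.

(* [q_0 = 0; q_1; ...; q_r; q_(r+1) = n] *)
Definition block_ends n (lam : n.-tuple nat) : seq nat :=
  0 :: rcons (sort leq (undup (column_lengths lam))) n.

Definition in_Snlam n (lam sigma : n.-tuple nat) : Prop :=
  is_perm_tuple sigma /\
  forall s i j, 1 <= s < size (block_ends lam) ->
    (nth 0 (block_ends lam) s.-1).+1 <= i -> i < j ->
    j <= nth 0 (block_ends lam) s ->
    nth 0 sigma i.-1 < nth 0 sigma j.-1.

Definition key n (lam sigma : n.-tuple nat) : filling :=
  [seq sort leq (take z sigma) | z <- column_lengths lam].

(* The empty maximum is 0, which is not a tableau value. *)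
Definition mwds_step (v : nat) (c : seq nat) : nat := \max_(x <- c | x <= v) x.

(* The values are listed from column [l] down to column 1. *)
Definition mwds (X : filling) (l k : nat) : seq nat :=
  entry X l k :: scanl mwds_step (entry X l k) (rev (take l.-1 X)).

Definition mwds_last (X : filling) (l k : nat) : nat := last 0 (mwds X l k).

(* The entries of a column are distinct, so a value of the path determines its
   location. *)
Definition remove_path (X : filling) (l k : nat) : filling :=
  [seq take (index cv.2 cv.1) cv.1 | cv <- zip (take l X) (rev (mwds X l k))].

(* The filling left after [m] paths, from rows [zeta_l, zeta_l - 1, ...] of
   column [l], have been removed. *)
Fixpoint scan_removed (T : filling) (l m : nat) : filling :=
  if m is m'.+1 then
    remove_path (scan_removed T l m') l (size (column T l) - m')
  else take l T.

(* T^(l,k) *)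
Definition scan_tab (T : filling) (l k : nat) : filling :=
  scan_removed T l (size (column T l) - k).

Definition left_scanning (T : filling) : filling :=
  [seq [seq mwds_last (scan_tab T l k) l k | k <- iota 1 (size (column T l))]
     | l <- iota 1 (size T)].

Definition itv (p q : nat) : pred nat := [pred x | p <= x <= q].

(* V^(l,k) *)
Definition Vtab (T : filling) (l k : nat) : filling :=
  take l.-1 (scan_tab T l k).

Definition Fq (n : nat) (T : filling) (l k : nat) : nat :=
  let V := Vtab T l k in
  \max_(1 <= i < (size (column V l.-1)).+1
        | entry V l.-1 i <= bentry n T l k.+1 - 1) i.

Definition Fp n (lam sigma : n.-tuple nat) (T : filling) (l k : nat)
    : option nat :=
  ohead [seq h <- index_iota k (Fq n T l k).+1
           | mwds_last (Vtab T l k) l.-1 h >= entry (key lam sigma) l k].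

Definition F n (lam sigma : n.-tuple nat) (T : filling) (l k : nat) : pred nat :=
  if l == 1 then itv (entry (key lam sigma) 1 k) (bentry n T 1 k.+1 - 1)
  else if Fp lam sigma T l k is Some p then
    itv (entry T l.-1 p) (bentry n T l k.+1 - 1)
  else pred0.

(* Main.v *)
(* The equivalence holds box by box, for an arbitrary bound [y] in place of
   [Y(l,k)].  For [l >= 2] the path from [(l,k)] enters column [l-1] at the
   lowest row [r] with [V(l-1,r) <= T(l,k)], so [k <= r <= q] and
   [M(l,k) = g_r].  As [g] is monotone in the starting value, [g_r >= y] holds
   iff [p] exists and [p <= r], that is, iff [T(l-1,p) <= T(l,k)]. *)

Require Import Defs.
From mathcomp Require Import all_boot.

(** * Increasing lists and conjugate partitions *)

(** Serves to read [Fp] as a minimum: the interval it filters is increasing, so the head of the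
    filtered list is its least element. *)
Lemma ohead_filter_sortedP (a : pred nat) (s : seq nat) :
  sorted leq s ->
  if ohead (filter a s) is Some p then
    [/\ p \in s, a p & forall r, r \in s -> a r -> p <= r]
  else forall r, r \in s -> ~~ a r.
Proof.
move=> s_sorted; have fs_sorted := sorted_filter leq_trans a s_sorted.
have mem_fs r : r \in s -> a r -> r \in filter a s.
  by move=> rs ar; rewrite mem_filter ar.
case fsE: (filter a s) fs_sorted mem_fs => [|p fs] /= ps mem_fs.
  by move=> r rs; apply/negP => /(mem_fs r rs).
have : p \in filter a s by rewrite fsE mem_head.
rewrite mem_filter => /andP[ap p_s]; split=> // r rs ar.
move: (mem_fs r rs ar); rewrite inE => /predU1P[-> //|r_fs].
by move: ps; rewrite path_sortedE; [case/andP=> /allP/(_ _ r_fs) | exact: leq_trans].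
Qed.

(** Conjugation: in a decreasing list the entries at least [l] form a prefix. With [0 < l], the
    default 0 past the end counts as too small. *)
Lemma leq_nth_count (s : seq nat) (k l : nat) :
  0 < l -> sorted geq s -> (l <= nth 0 s k) = (k < count (leq l) s).
Proof.
move=> l_gt0; elim: s k => [|x s IHs] k.
  by rewrite nth_nil ltn0 leqNgt l_gt0.
move=> xs_sorted; have s_sorted := path_sorted xs_sorted.
have [lx|xl] := leqP l x; first by case: k => [|k] /=; rewrite lx // IHs.
have s_lt y : y \in s -> y < l.
  move: xs_sorted; rewrite /= path_sortedE; last by move=> ? ? ? h1 h2; exact: leq_trans h2 h1.
  by case/andP=> /allP xs _ /xs yx; exact: leq_ltn_trans yx xl.
have /eqP -> : count (leq l) (x :: s) == 0.
  rewrite -leqn0 leqNgt -has_count; apply/hasPn => y.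
  by rewrite inE -ltnNge => /predU1P[->|/s_lt].
rewrite ltn0 leqNgt; apply/negbF.
case: k => [|k] //=; have [ks|sk] := ltnP k (size s); first exact/s_lt/mem_nth.
by rewrite nth_default.
Qed.

(** * Maximizing weakly decreasing sequences *)

(** A larger bound admits more entries of [c]. Iterated over the columns, this makes the last value
    of a path monotone in its starting value. *)
Lemma mwds_step_homo (c : seq nat) (v w : nat) :
  v <= w -> mwds_step v c <= mwds_step w c.
Proof.
move=> vw; apply/bigmax_leqP_seq => x xc xv.
by apply: (bigmaxn_sup_seq x) => //; exact: leq_trans xv vw.
Qed.

Lemma foldl_mwds_step_homo (s : seq (seq nat)) (v w : nat) :
  v <= w -> foldl mwds_step v s <= foldl mwds_step w s.
Proof. by elim: s v w => //= c s IHs v w /(mwds_step_homo c)/IHs. Qed.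

(** The lowest row whose entry is at most [v] attains the maximum. The given row [i] excludes the
    empty maximum 0 and bounds that row from above, so a path does not rise past [i]. *)
Lemma mwds_step_nth (c : seq nat) (v i : nat) :
  sorted ltn c -> i < size c -> nth 0 c i <= v ->
  exists r, [/\ i <= r, r < size c, nth 0 c r <= v & mwds_step v c = nth 0 c r].
Proof.
move=> c_sorted ic civ.
have ex_r : exists r, (r < size c) && (nth 0 c r <= v) by exists i; rewrite ic.
have r_max r : (r < size c) && (nth 0 c r <= v) -> r <= size c.
  by case/andP=> /ltnW.
case: (ex_maxnP ex_r r_max) => r /andP[rc crv] r_maxi.
exists r; split=> //; first by apply: r_maxi; rewrite ic.
apply/eqP; rewrite eqn_leq; apply/andP; split; last first.
  by apply: (bigmaxn_sup_seq (nth 0 c r)) => //; exact: mem_nth.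
apply/bigmax_leqP_seq => x xc xv; rewrite -(nth_index 0 xc).
have jc : index x c < size c by rewrite index_mem.
apply: (sorted_leq_nth leq_trans leqnn) => //; first exact: sub_sorted ltnW _ c_sorted.
by apply: r_maxi; rewrite jc nth_index.
Qed.

Lemma mwds_lastE (X : filling) (l k : nat) :
  mwds_last X l k = foldl mwds_step (entry X l k) (rev (take l.-1 X)).
Proof.
rewrite /mwds_last /mwds /= (last_nth 0) size_scanl nth_cons_scanl //.
by rewrite take_size.
Qed.

Lemma mwds_last_homo (X : filling) (l i j : nat) :
  entry X l i <= entry X l j -> mwds_last X l i <= mwds_last X l j.
Proof. by rewrite !mwds_lastE; exact: foldl_mwds_step_homo. Qed.

(** Peels off the first step of a path, which turns [M(l,k)] into some [g_r] computed in [V]. *)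
Lemma mwds_last_step (X : filling) (l k r : nat) : l.+1 < size X ->
  mwds_step (entry X l.+2 k) (column X l.+1) = entry X l.+1 r ->
  mwds_last X l.+2 k = mwds_last (take l.+1 X) l.+1 r.
Proof.
move=> lX step_r; rewrite !mwds_lastE /= take_takel //.
have -> : entry (take l.+1 X) l.+1 r = entry X l.+1 r by rewrite /entry /column nth_take.
by rewrite (take_nth [::]) ?(ltnW lX) // rev_rcons /= -step_r.
Qed.

(** * Columns after the removal of paths *)

Lemma size_mwds (X : filling) (l k : nat) : l < size X -> size (mwds X l.+1 k) = l.+1.
Proof. by move=> lX; rewrite /= size_scanl size_rev size_takel // ltnW. Qed.

Lemma size_remove_path (X : filling) (l k : nat) :
  l < size X -> size (remove_path X l.+1 k) = l.+1.
Proof.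
by move=> lX; rewrite size_map size_zip size_rev size_mwds // size_takel ?minnn.
Qed.

(** A path is listed from right to left and the columns from left to right, whence the position
    [l - j]. *)
Lemma column_remove_path (X : filling) (l k j : nat) : l < size X -> j <= l ->
  column (remove_path X l.+1 k) j.+1 =
    take (index (nth 0 (mwds X l.+1 k) (l - j)) (column X j.+1)) (column X j.+1).
Proof.
move=> lX jl; have sz : size (take l.+1 X) = size (rev (mwds X l.+1 k)).
  by rewrite size_rev size_mwds // size_takel.
rewrite /column (nth_map ([::], 0)) ?size_zip -?sz ?minnn ?size_takel //.
by rewrite nth_zip //= nth_rev ?size_mwds // subSS nth_take.
Qed.

Section Scan.

Variables (T : filling) (l : nat).
Hypotheses (l_lt : l < size T) (c_sorted : sorted ltn (column T l.+1)).

(** Each path starts in the bottom box left in the last column, so its removal costs that column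
    exactly one box. *)
Lemma scan_removedP (m : nat) : m <= size (column T l.+1) ->
  size (scan_removed T l.+1 m) = l.+1 /\
  column (scan_removed T l.+1 m) l.+1 =
    take (size (column T l.+1) - m) (column T l.+1).
Proof.
elim: m => [|m IHm] m_le /=.
  by rewrite size_takel // subn0 take_size /column nth_take.
have [szX colX] := IHm (ltnW m_le); set X := scan_removed _ _ _ in szX colX *.
rewrite size_remove_path ?szX // column_remove_path ?szX // subnn /=.
have [k sz] : exists k, size (column T l.+1) - m = k.+1.
  by exists (size (column T l.+1) - m).-1; rewrite prednK // subn_gt0.
rewrite /entry colX sz /= subnS sz /= index_uniq.
- by rewrite take_takel.
- by rewrite size_takel // -sz leq_subr.
by apply/take_uniq/(sorted_uniq ltn_trans ltnn).
Qed.

Lemma scan_tabP (k : nat) : k <= size (column T l.+1) ->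
  size (scan_tab T l.+1 k) = l.+1 /\
  column (scan_tab T l.+1 k) l.+1 = take k (column T l.+1).
Proof.
by move=> k_le; have [szX] := scan_removedP _ (leq_subr k _); rewrite subKn.
Qed.

End Scan.

Section ScanPrev.

Variables (T : filling) (l : nat).
Hypotheses (l_lt : l.+1 < size T).
Hypotheses (c_sorted : sorted ltn (column T l.+2)).
Hypotheses (c0_sorted : sorted ltn (column T l.+1)).
Hypothesis sizes : size (column T l.+2) <= size (column T l.+1).
Hypothesis rows : forall i, i < size (column T l.+2) ->
  nth 0 (column T l.+1) i <= nth 0 (column T l.+2) i.

(* Rows weakly increase, so a path never moves up when it goes left: truncating
   along it keeps the left one of the two columns at least as long. *)
Lemma scan_removed_prev (m : nat) : m <= size (column T l.+2) ->
  exists h, [/\ size (column T l.+2) - m <= h, h <= size (column T l.+1)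
    & column (scan_removed T l.+2 m) l.+1 = take h (column T l.+1)].
Proof.
elim: m => [|m IHm] m_le.
  exists (size (column T l.+1)); split; rewrite ?leqnn ?subn0 //.
  by rewrite take_size /= /column nth_take.
have [h [h_ge h_le prevX]] := IHm (ltnW m_le).
have [szX colX] := scan_removedP _ _ l_lt c_sorted _ (ltnW m_le).
rewrite /=; set X := scan_removed _ _ _ in szX colX prevX *.
have [k sz] : exists k, size (column T l.+2) - m = k.+1.
  by exists (size (column T l.+2) - m).-1; rewrite prednK // subn_gt0.
have k_lt : k < size (column T l.+2) by rewrite -sz leq_subr.
rewrite column_remove_path ?szX ?leqnSn //.
rewrite subSnn subnS sz /=; rewrite sz in h_ge.
rewrite (take_nth [::]) ?szX // rev_rcons -[nth [::] X l]/(column X l.+1) /=.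
rewrite prevX /entry colX sz /= nth_take //.
have szh : size (take h (column T l.+1)) = h by rewrite size_takel.
have th_sorted : sorted ltn (take h (column T l.+1)) by exact: take_sorted.
have [||r [kr rh _ ->]] := mwds_step_nth _ (nth 0 (column T l.+2) k) k th_sorted.
- by rewrite szh.
- by rewrite nth_take // rows.
(* The path meets the left column in row [r], counted from 0, so exactly the [r] boxes above it
   survive. *)
exists r; rewrite kr index_uniq //; last exact: sorted_uniq ltn_trans ltnn _ th_sorted.
rewrite szh in rh; split=> //; first exact: leq_trans (ltnW rh) h_le.
by rewrite take_takel // ltnW.
Qed.

Lemma scan_tab_prev (k : nat) : k <= size (column T l.+2) ->
  exists h, [/\ k <= h, h <= size (column T l.+1)
    & column (scan_tab T l.+2 k) l.+1 = take h (column T l.+1)].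
Proof.
by move=> k_le; have := scan_removed_prev _ (leq_subr k _); rewrite subKn.
Qed.

End ScanPrev.

(** * The equivalence at one box of a semistandard tableau *)

Section Semistandard.

Variables (n : nat) (lam : n.-tuple nat) (T : filling).
Hypotheses (hlam : is_partition lam) (hT : semistandard lam T).

Lemma boxE (j i : nat) :
  box lam j i = [&& 0 < j, 0 < i & i <= zeta lam j].
Proof.
rewrite /box /part /zeta; case: j i => [|j] [|i] //=; first by rewrite andbF.
rewrite leq_nth_count // andb_idl // => i_lt.
by apply: leq_trans i_lt _; rewrite -{2}(size_tuple lam) count_size.
Qed.

Lemma size_column (l : nat) : 0 < l -> size (column T l) = zeta lam l.
Proof.
case: l => [//|l] _; have [shT _ _ _] := hT.
have szT : size T = part lam 1 by rewrite -(size_map size) -/(shape T) shT size_map size_iota.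
rewrite /column /=; have [lT|Tl] := ltnP l (size T).
  rewrite -(nth_map _ 0 size) // -/(shape T) shT (nth_map 0) ?size_iota -?szT //.
  by rewrite nth_iota -?szT.
(* Past the last column, the default column is empty and no part of [lam] reaches [l.+1]. *)
rewrite nth_default //=; apply/esym/eqP; rewrite -leqn0 leqNgt.
by rewrite -leq_nth_count // -ltnNge -[nth _ _ _]/(part lam 1) -szT ltnS.
Qed.

Lemma box_column (l k : nat) :
  box lam l.+1 k.+1 = (k < size (column T l.+1)).
Proof. by rewrite boxE size_column. Qed.

Lemma box_lt_size (l k : nat) : box lam l.+1 k -> l < size T.
Proof.
case: k => [|k]; first by rewrite boxE.
rewrite box_column; apply: contraLR; rewrite -leqNgt => Tl.
by rewrite /column nth_default.
Qed.

Lemma column_sorted (l : nat) : sorted ltn (column T l.+1).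
Proof.
have [_ _ _ hcol] := hT; apply/(sortedP 0) => i i_lt.
by apply: (hcol l.+1 i.+1); rewrite box_column // ltnW.
Qed.

Lemma size_column_homo (l : nat) : size (column T l.+2) <= size (column T l.+1).
Proof. by rewrite !size_column //; apply: sub_count => m /ltnW. Qed.

Lemma column_le (l i : nat) : i < size (column T l.+2) ->
  nth 0 (column T l.+1) i <= nth 0 (column T l.+2) i.
Proof.
move=> i_lt; have [_ _ hrow _] := hT; apply: (hrow l.+1 i.+1); rewrite box_column //.
exact: leq_trans i_lt (size_column_homo l).
Qed.

Lemma entry_lt_bentry (l k : nat) : box lam l k -> entry T l k < bentry n T l k.+1.
Proof.
move=> blk; have [_ hn _ hcol] := hT; rewrite /bentry; case: ifP => [k_lt|_].
  apply: hcol => //; case: l k blk k_lt => [|l] k; first by rewrite boxE.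
  by rewrite box_column.
by case/andP: (hn _ _ blk).
Qed.

Lemma entry_left_scanning (l k : nat) : box lam l k ->
  entry (left_scanning T) l k = mwds_last (scan_tab T l k) l k.
Proof.
case: l k => [|l] [|k]; rewrite ?boxE ?andbF // -boxE => blk.
have lT := box_lt_size _ _ blk; rewrite box_column in blk.
rewrite /entry /column (nth_map 0) ?size_iota // nth_iota //= add1n.
by rewrite (nth_map 0) ?size_iota // nth_iota.
Qed.

Lemma left_scanning_geP (sigma : n.-tuple nat) (l k : nat) : box lam l k ->
  (entry (key lam sigma) l k <= entry (left_scanning T) l k) =
  (entry T l k \in F lam sigma T l k).
Proof.
move=> blk; rewrite entry_left_scanning // /F; set y := entry (key _ _) l k.
have T_lt := entry_lt_bentry _ _ blk.
set b := bentry n T l k.+1 in T_lt *.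
(* The upper end of [F] always holds, so only its lower end matters. *)
have T_le : entry T l k <= b - 1 by rewrite subn1 -ltnS (ltn_predK T_lt).
case: l k blk @y @b T_lt T_le => [|l] [|k]; rewrite ?boxE ?andbF // -boxE.
move=> blk y b T_lt T_le; have lT := box_lt_size _ _ blk.
have k_lt : k < size (column T l.+1) by rewrite -box_column.
have [szX colX] := scan_tabP _ _ lT (column_sorted _) _ k_lt.
have entryX : entry (scan_tab T l.+1 k.+1) l.+1 k.+1 = entry T l.+1 k.+1.
  by rewrite /entry colX nth_take.
(* In the first column the path is the single value [T(1,k)]. *)
case: l => [|l] in blk y b T_lt T_le lT k_lt szX colX entryX *.
  by rewrite mwds_lastE entryX take0 /= inE T_le andbT.
have [h [k_h h_le prevX]] := scan_tab_prev _ _ lT (column_sorted _)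
  (column_sorted _) (size_column_homo _) (column_le _) _ k_lt.
rewrite eqSS /Fp -/y; set V := Vtab T l.+2 k.+1; set q := Fq _ _ _ _.
set X := scan_tab _ _ _ in szX colX prevX entryX *.
set c := take h _ in prevX.
have szc : size c = h by rewrite size_takel.
have c_sorted : sorted ltn c by exact/take_sorted/column_sorted.
have colV : column V l.+1 = c by rewrite -prevX /column nth_take.
have entryV i : entry V l.+1 i = nth 0 c i.-1 by rewrite /entry colV.
have V_homo i j : i <= j -> j <= h -> entry V l.+1 i <= entry V l.+1 j.
  move=> ij jh; rewrite !entryV.
  (* Because of [i.-1], row 0 reads as row 1, so no positivity of [i] is required. *)
  case: j ij jh => [|j] ij jh; first by move: ij; rewrite leqn0 => /eqP->.
  apply: (sorted_leq_nth leq_trans leqnn 0 (sub_sorted ltnW c_sorted)).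
  - by rewrite inE szc; case: i ij => [|i] ij; apply: leq_trans jh.
  - by rewrite inE szc.
  by case: i ij.
have q_le : q <= h.
  by apply/bigmax_leqP_seq => i; rewrite /= -/V colV szc mem_index_iota => /andP[].
(* Here [k] and [r] count from 0: the path enters the left column in row [r.+1]. *)
have [||r [kr rh cr step_r]] := mwds_step_nth _ (entry T l.+2 k.+1) k c_sorted.
- by rewrite szc.
- by rewrite nth_take // column_le.
rewrite szc in rh.
have Mr : mwds_last X l.+2 k.+1 = mwds_last V l.+1 r.+1.
  apply: mwds_last_step; first by rewrite szX.
  by rewrite prevX entryX step_r /entry prevX.
have q_ge i : 0 < i <= h -> entry V l.+1 i <= b - 1 -> i <= q.
  move=> ih Vi; apply: (bigmaxn_sup_seq i) => //.
  by rewrite /= -/V colV szc mem_index_iota.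
have r_le : r < q.
  by apply: q_ge => //; rewrite entryV (leq_trans cr).
have entryVT i : 0 < i <= h -> entry T l.+1 i = entry V l.+1 i.
  by case: i => [|i] // ih; rewrite entryV nth_take.
have := @ohead_filter_sortedP (fun i => y <= mwds_last V l.+1 i) _
  (iota_sorted k.+1 (q.+1 - k.+1)).
rewrite Mr -/(index_iota k.+1 q.+1) /=.
case: ohead => [p [] | nog]; last first.
  (* Without [p], the value from row [r.+1] is itself below [y], and both sides are false. *)
  by apply/negbTE/nog; rewrite mem_index_iota !ltnS kr r_le.
rewrite mem_index_iota ltnS => /andP[kp pq] yp p_min.
have ph : 0 < p <= h by rewrite (leq_ltn_trans _ kp) // (leq_trans pq).
rewrite inE T_le andbT entryVT //; apply/idP/idP.
  move=> /p_min p_le; apply: leq_trans cr.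
  by rewrite -[nth _ _ _](entryV r.+1) V_homo // p_le // mem_index_iota !ltnS kr r_le.
(* Row [p] competes in the maximum that selects row [r.+1], so its entry is no larger, and neither
   is the end of its path. *)
move=> Vp; apply: leq_trans yp _; apply: mwds_last_homo.
rewrite (entryV r.+1) -step_r; apply: (bigmaxn_sup_seq (entry V l.+1 p)) => //.
by rewrite entryV mem_nth // szc prednK; case/andP: ph.
Qed.

End Semistandard.

Theorem theorem9p1 (n : nat) (hn : 1 <= n) (lam : n.-tuple nat)
    (hlam : is_partition lam) (sigma : n.-tuple nat)
    (hsigma : in_Snlam lam sigma) (T : filling) (hT : semistandard lam T) :
  tab_le lam (key lam sigma) (left_scanning T) <->
  (forall l k : nat, box lam l k -> entry T l k \in F lam sigma T l k).
Proof.
by split=> M_ge l k blk; move: (M_ge l k blk); rewrite left_scanning_geP.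
Qed.
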